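(* Let $\mathcal{M}=(G,\{1\},\{|V|\},V)$ be a linear compartmental model (with a leak in every compartment) where $G$ is a directed path from the input $1$ to the output $|V|$ with $|V|-1$ edges (i.e. with edges $1\to 2\to\cdots\to|V|$). Then $\mathcal{M}$ is an identifiable path/cycle model, and the model $\widetilde{\mathcal{M}}=(G,\{1\},\{|V|\},\{1,|V|\})$ is locally identifiable.
   Context: A linear compartmental model $(G,In,Out,Leak)$ consists of a finite directed graph $G=(V,E)$ (no self-loops, no repeated edges) and subsets $In,Out,Leak\subseteq V$ (input, output and leak compartments; $In,Out$ nonempty). Each edge $j\to i$ carries an independent parameter $a_{ij}$ and each $i\in Leak$ an independent parameter $a_{0i}$. The compartmental matrix $A$ has $A_{ij}=a_{ij}$ if $j\to i\in E$; $A_{ii}=-a_{0i}-\sum_{k:\,i\to k\in E}a_{ki}$ if $i\in Leak$; $A_{ii}=-\sum_{k:\,i\to k\in E}a_{ki}$ if $i\notin Leak$; all other entries $0$. The model is the system $x'=Ax+u$, $y_i=x_i$ for $i\in Out$, with $u_i\equiv 0$ for $i\notin In$. When $Leak=V$, the diagonal entries $a_{ii}:=A_{ii}$ are algebraically independent and are used as parameters in place of the $a_{0i}$. When every vertex has a directed path to every output (which holds here), the input-output equation for $j\in Out$ is $\det(\partial I-A)\,y_j=\sum_{i\in In}(-1)^{i+j}\det(\partial I-A)_{ij}\,u_i$, where $\partial=d/dt$ and $(\cdot)_{ij}$ means delete row $i$ and column $j$. The coefficient map $c:\mathbb{R}^{|E|+|Leak|}\to\mathbb{R}^k$ collects all nonzero,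 nonmonic coefficients (polynomials in the parameters) of these equations over all $j\in Out$. A cycle is a closed directed path with no repeated vertices; to a cycle or directed path associate the monomial that is the product of the parameters of its edges. The diagonal entries $a_{ii}$ count as monomial cycles of length 1 (self-cycles). A function $f$ of the parameters is locally identifiable (from $c$) if there is a finitely multivalued function $\Phi$ with $\Phi\circ c=f$ (generically). A model $(G,In,Out,V)$ is an identifiable path/cycle model if all of the independent monomial cycles (including self-cycles) and monomial paths from input to output are locally identifiable and each parameter is contained in such a cycle or path. A model is (generically) locally identifiable if, outside a set of measure zero in parameter space, every point has a neighborhood on which $c$ is one-to-one; equivalently, the Jacobian of $c$ has rank $|E|+|Leak|$ at a generic point. *)

(* Defs.v *)
From HB Require Import structures.
From mathcomp Require Import all_boot all_order all_algebra.
From mathcomp Require Import all_classical all_reals all_analysis.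

Set Implicit Arguments.
Unset Strict Implicit.
Unset Printing Implicit Defensive.

Import Order.TTheory GRing.Theory Num.Theory.
Import numFieldNormedType.Exports.

Local Open Scope ring_scope.

(* The vertices are ordered ('I_n) because the signs (-1)^(i+j) of the
   input-output equations refer to row and column numbers; vertex number k of
   the mathematics is the ordinal of value k - 1.  [edge i j] means i -> j. *)
Record compartmental_model (n : nat) := CompartmentalModel {
  edge : rel 'I_n;
  inputs : {set 'I_n};
  outputs : {set 'I_n};
  leaks : {set 'I_n};
  edge_irreflexive : irreflexive edge;
  inputs_neq0 : inputs != finset.set0;
  outputs_neq0 : outputs != finset.set0 }.

Section ParameterSpace.
Variables (n : nat) (M : compartmental_model n).

Definition edge_type := {e : 'I_n * 'I_n | edge M e.1 e.2}.
Definition leak_type := {i : 'I_n | i \in leaks M}.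

(* inl (j, i) stands for a_ij (edge j -> i); inr i stands for a_0i, or for a_ii
   when the diagonal parametrization below is used. *)
Definition param := (edge_type + leak_type)%type.

Definition param_space (R : realType) := 'rV[R]_#|{: param}|.

Variable R : realType.
Implicit Type t : param_space R.

Definition param_val t (p : param) : R := t ord0 (enum_rank p).

Definition edge_val t (j i : 'I_n) : R :=
  if insub (j, i) is Some e then param_val t (inl e) else 0.

Definition leak_val t (i : 'I_n) : R :=
  if insub i is Some l then param_val t (inr l) else 0.

Definition compartmental_mx t : 'M[R]_n :=
  \matrix_(i, j)
    if i == j then - leak_val t i - \sum_(k | edge M i k) edge_val t i k
    else edge_val t j i.

(* Meant for models with a leak in every compartment: the parameter of the leak
   at i is now a_ii itself, related to a_0i by the invertible linear change of
   parameters a_ii = - a_0i - \sum_(i -> k) a_ki. *)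
Definition diag_compartmental_mx t : 'M[R]_n :=
  \matrix_(i, j) if i == j then leak_val t i else edge_val t j i.

End ParameterSpace.

Section CoefficientMap.
Variables (n : nat) (M : compartmental_model n) (R : realType).

(* (j, None, k): coefficient of d^k on the left-hand side of the input-output
   equation of output j, det(d I - A) y_j;
   (j, Some i, k): coefficient of d^k in (-1)^(i+j) det(d I - A)_ij, the factor
   of u_i in that equation. *)
Definition coef_index := ('I_n * option 'I_n * 'I_n.+1)%type.

Definition io_coef (A : 'M[R]_n) (x : coef_index) : R :=
  let: (j, o, k) := x in
  if o is Some i then (cofactor (char_poly_mx A) i j)`_k else (char_poly A)`_k.

(* A parametrization of the matrix A of the model: [@compartmental_mx n M R] or
   [@diag_compartmental_mx n M R]. *)
Variable mx : param_space M R -> 'M[R]_n.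

(* The coefficients are polynomials in the parameters, and a polynomial over R
   is determined by its values.  The coefficient of d^k is homogeneous in the
   parameters, of degree 0 only if it is the leading coefficient 1 of a monic
   polynomial (or 0); so nonmonic means not identically 1. *)
Definition relevant_coef (x : coef_index) : bool :=
  let: (j, o, k) := x in
  [&& j \in outputs M, (if o is Some i then i \in inputs M else true),
      `[< exists t, io_coef (mx t) x != 0 >]
    & `[< exists t, io_coef (mx t) x != 1 >]].

Definition coefficient_map (t : param_space M R) :
    {ffun {x : coef_index | relevant_coef x} -> R} :=
  [ffun x => io_coef (mx t) (val x)].

End CoefficientMap.

Section Generic.
Local Open Scope classical_set_scope.

(* Lebesgue measure zero in R^m, by coverings with countably many boxes.  The
   index set D allows the empty covering, needed in dimension 0, where the only
   nonempty box is the whole space and has volume 1. *)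
Definition measure_zero (R : realType) (m : nat) (N : set 'rV[R]_m) : Prop :=
  forall e : R, 0 < e ->
    exists (D : set nat) (a b : nat -> 'rV[R]_m),
      [/\ forall k i, a k ord0 i <= b k ord0 i,
          N `<=` \bigcup_(k in D)
                   [set x : 'rV[R]_m | forall i, a k ord0 i <= x ord0 i <= b k ord0 i]
        & (\esum_(k in D) (\prod_i (b k ord0 i - a k ord0 i))%:E <= e%:E)%E].

Definition generically (R : realType) (m : nat) (P : 'rV[R]_m -> Prop) : Prop :=
  measure_zero [set t | ~ P t].

(* The finitely multivalued function is encoded by its finite sets of values. *)
Definition locally_identifiable_from (R : realType) (m : nat) (T : Type)
    (c : 'rV[R]_m -> T) (f : 'rV[R]_m -> R) : Prop :=
  exists Phi : T -> set R,
    (forall y, finite_set (Phi y)) /\ generically (fun t => Phi (c t) (f t)).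

Definition locally_identifiable (R : realType) (n : nat)
    (M : compartmental_model n) : Prop :=
  generically (fun t : param_space M R =>
    exists2 U : set (param_space M R), nbhs t U &
      {in U &, injective (coefficient_map (@compartmental_mx n M R))}).

End Generic.

Section PathCycle.
Variables (n : nat) (M : compartmental_model n).

(* In the diagonal parametrization, an arc (j, i) carries the parameter a_ij,
   including a_ii for the self-cycle (i, i). *)
Definition arc_param (e : 'I_n * 'I_n) : option (param M) :=
  if e.1 == e.2 then omap inr (insub e.1 : option (leak_type M))
  else omap inl (insub e : option (edge_type M)).

(* The parameters on the walk x -> s_0 -> s_1 -> ... *)
Definition walk_params (x : 'I_n) (s : seq 'I_n) : seq (param M) :=
  pmap arc_param (pairmap pair x s).

(* A monomial is represented by the list of its factors. *)
Definition monomial_cycle (m : seq (param M)) : Prop :=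
  exists (x : 'I_n) (s : seq 'I_n),
    [/\ uniq (x :: s), (s == [::]) || cycle (edge M) (x :: s)
      & m = walk_params x (rcons s x)].

Definition monomial_io_path (m : seq (param M)) : Prop :=
  exists (x : 'I_n) (s : seq 'I_n),
    [/\ x \in inputs M, last x s \in outputs M, uniq (x :: s),
        path (edge M) x s & m = walk_params x s].

Definition monomial_val (R : realType) (m : seq (param M))
    (t : param_space M R) : R := \prod_(p <- m) param_val t p.

(* A nonconstant monomial is algebraically independent by itself, so the
   independent monomials range over all (nonconstant) monomial cycles and
   paths. *)
Definition identifiable_path_cycle_model (R : realType) : Prop :=
  [/\ leaks M = [set: 'I_n]%SET,
      forall m, monomial_cycle m \/ monomial_io_path m ->
        locally_identifiable_from (coefficient_map (@diag_compartmental_mx n M R))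
          (@monomial_val R m)
    & forall p : param M,
        exists2 m, monomial_cycle m \/ monomial_io_path m & p \in m].

End PathCycle.

Section PathModel.
Variable n : nat.

Definition path_edge : rel 'I_n.+1 := fun i j => j == i.+1 :> nat.

Lemma path_edge_irreflexive : irreflexive path_edge.
Proof. by move=> i; rewrite /path_edge ltn_eqF. Qed.

Lemma set1_ord_neq0 (i : 'I_n.+1) : [set i]%SET != finset.set0.
Proof. by apply/finset.set0Pn; exists i; rewrite inE. Qed.

(* The directed path 1 -> 2 -> ... -> |V| with |V| = n + 1, input 1 and
   output |V|. *)
Definition path_model (L : {set 'I_n.+1}) : compartmental_model n.+1 :=
  @CompartmentalModel n.+1 path_edge [set ord0]%SET [set ord_max]%SET L
    path_edge_irreflexive (set1_ord_neq0 ord0) (set1_ord_neq0 ord_max).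

End PathModel.

(* Main.v *)
From HB Require Import structures.
Require Import Defs.
From mathcomp Require Import all_boot all_order all_algebra.
From mathcomp Require Import all_classical all_reals all_analysis.
From mathcomp Require Import ring lra.

(** Along a directed path the compartmental matrix [A] is lower bidiagonal: its
    diagonal carries the self-cycles and its subdiagonal the edge parameters.  Hence
    [char_poly A] is the product of the ['X - A i i] ([char_poly_bidiagonal]), and the
    only cofactor in the input-output equation is the product of all edge
    parameters ([cofactor_bidiagonal]).  The coefficient map thus determines exactly
    the multiset of the diagonal entries and the monomial of the unique input-output
    path ([diag_fibre], [prod_subdiag_fibre]).

    With a leak in every compartment the only monomial cycles are the self-cycles.
    On a fibre of the coefficient map each of them takes finitely many values, the
    eigenvalues of any one matrix of the fibre, and the path monomial takes one.

    With leaks at the two ends only, take a point where the diagonal entries are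
    distinct and the edge parameters nonzero.  On a small enough neighborhood, two
    points with equal coefficients have equal diagonals, because the eigenvalues
    cannot be exchanged.  Inner diagonal entries are opposites of edge parameters; the
    first edge parameter is then the path monomial divided by the others, and the two
    leaks follow from the first and last diagonal entries ([compartmental_mx_inj]).

    The excluded points form a finite union of kernels of nonzero linear forms.  Such
    a kernel has measure zero ([measure_zero_kernel]), being the graph of a linear
    function of all coordinates but one, which thin boxes over a fine grid cover
    ([measure_zero_graph]). *)

Set Implicit Arguments.
Unset Strict Implicit.
Unset Printing Implicit Defensive.

Import Order.TTheory GRing.Theory Num.Theory.
Import numFieldNormedType.Exports.

Local Open Scope ring_scope.

(** * Linear forms *)

Section LinearForms.
Variables (R : realType) (m : nat) (phi : 'rV[R]_m -> R^o).
Hypothesis phi_lin : linear phi.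

Lemma linear_form_sum x : phi x = \sum_j x ord0 j * phi (delta_mx ord0 j).
Proof.
pose phiL : {linear 'rV[R]_m -> R^o} :=
  HB.pack phi (GRing.isLinear.Build R 'rV[R]_m R^o _ phi phi_lin).
have phiE y : phi y = phiL y by [].
rewrite [x in LHS]row_sum_delta phiE linear_sum.
by apply: eq_bigr => j _; rewrite linearZ phiE.
Qed.

Lemma linear_form_continuous : continuous phi.
Proof.
have -> : phi = fun x => \sum_j x ord0 j * phi (delta_mx ord0 j).
  by apply/funext => x; apply: linear_form_sum.
apply: continuous_big => [|j _ x]; first exact: (@add_continuous R^o).
apply: cvgMr_tmp; first exact: nbhs_filter.
exact: (@coord_continuous R 1 m ord0 j x).
Qed.

End LinearForms.

(** * Sets of measure zero *)

Section MeasureZero.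
Local Open Scope classical_set_scope.
Variables (R : realType) (m : nat).
Implicit Types N : set 'rV[R]_m.

Lemma measure_zeroS N N' : N `<=` N' -> measure_zero N' -> measure_zero N.
Proof.
move=> sNN' mN' e e_gt0; have [D [a [b [le_ab covN' vol]]]] := mN' e e_gt0.
by exists D, a, b; split=> //; apply: subset_trans covN'.
Qed.

Lemma measure_zero0 : measure_zero (set0 : set 'rV[R]_m).
Proof.
move=> e e_gt0; exists set0, (fun=> 0), (fun=> 0); split=> //.
by rewrite esum_set0 lee_fin ltW.
Qed.

(** Coverings by boxes may be indexed by any countable type. *)
Lemma measure_zero_countable_cover N :
  (forall e : R, 0 < e ->
     exists (I : countType) (D : set I) (a b : I -> 'rV[R]_m),
      [/\ forall k i, a k ord0 i <= b k ord0 i,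
          N `<=` \bigcup_(k in D)
                   [set x : 'rV[R]_m | forall i, a k ord0 i <= x ord0 i <= b k ord0 i]
        & (\esum_(k in D) (\prod_i (b k ord0 i - a k ord0 i))%:E <= e%:E)%E]) ->
  measure_zero N.
Proof.
move=> covN e /covN[I [D [a [b [le_ab covD vol]]]]].
pose ext (f : I -> 'rV[R]_m) k := if unpickle k is Some i then f i else 0.
exists (pickle @` D), (ext a), (ext b); split.
- by move=> k i; rewrite /ext; case: unpickle => // _; rewrite lexx.
- move=> x /covD[k Dk xk]; exists (pickle k); first by exists k.
  by rewrite /= /ext pickleK.
- rewrite esum_image; last by move=> i j _ _; apply: pcan_inj (@pickleK I) _ _.
  by under eq_esum do rewrite /ext pickleK.
Qed.

Lemma measure_zero_bigcup (N_ : nat -> set 'rV[R]_m) :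
  (forall k, measure_zero (N_ k)) -> measure_zero (\bigcup_k N_ k).
Proof.
move=> mN; apply: measure_zero_countable_cover => e e_gt0.
have /choice[c cP] k : exists c : set nat * (nat -> 'rV[R]_m) * (nat -> 'rV[R]_m),
   [/\ forall l i, c.1.2 l ord0 i <= c.2 l ord0 i,
       N_ k `<=` \bigcup_(l in c.1.1)
          [set x : 'rV[R]_m | forall i, c.1.2 l ord0 i <= x ord0 i <= c.2 l ord0 i]
     & (\esum_(l in c.1.1) (\prod_i (c.2 l ord0 i - c.1.2 l ord0 i))%:E <=
          (e / (2 ^ k.+1)%:R)%:E)%E].
  have e2_gt0 : 0 < e / (2 ^ k.+1)%:R by rewrite divr_gt0 // ltr0n expn_gt0.
  by have [D [a [b Dab]]] := mN k _ e2_gt0; exists (D, a, b).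
exists (nat * nat)%type, (setT `*`` fun k => (c k).1.1),
  (fun kl => (c kl.1).1.2 kl.2), (fun kl => (c kl.1).2 kl.2); split.
- by move=> [k l] i; have [le_ab _ _] := cP k; apply: le_ab.
- move=> x [k _ Nkx]; have [_ cov _] := cP k; have [l Dl xl] := cov x Nkx.
  by exists (k, l).
- rewrite -(@esum_esum R _ _ setT (fun k => (c k).1.1)
    (fun k l => (\prod_i ((c k).2 l ord0 i - (c k).1.2 l ord0 i))%:E)); last first.
    move=> k l _ _; rewrite lee_fin; apply: prodr_ge0 => i _.
    by have [le_ab _ _] := cP k; rewrite subr_ge0.
  apply: le_trans (epsilon_trick0 xpredT (ltW e_gt0)).
  rewrite nneseries_esumT; last first.
    by move=> k; rewrite lee_fin divr_ge0 ?ltW // ltr0n expn_gt0.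
  by apply: le_esum => k _; have [] := cP k.
Qed.

Lemma measure_zero_bigcup_countable (I : countType) (N_ : I -> set 'rV[R]_m) :
  (forall k, measure_zero (N_ k)) -> measure_zero (\bigcup_k N_ k).
Proof.
move=> mN; pose N' k := if unpickle k is Some i then N_ i else set0.
apply: (@measure_zeroS _ (\bigcup_k N' k)).
  by move=> x [i _ Nix]; exists (pickle i) => //; rewrite /N' pickleK.
apply: measure_zero_bigcup => k; rewrite /N'.
by case: unpickle => // ; apply: measure_zero0.
Qed.

Lemma measure_zero_finite_cover N :
  (forall e : R, 0 < e -> exists (I : finType) (a b : I -> 'rV[R]_m),
      [/\ forall k i, a k ord0 i <= b k ord0 i,
          forall x, N x -> exists k, forall i, a k ord0 i <= x ord0 i <= b k ord0 i
        & \sum_k \prod_i (b k ord0 i - a k ord0 i) <= e]) ->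
  measure_zero N.
Proof.
move=> covN; apply: measure_zero_countable_cover => e /covN[I [a [b [le_ab cov vol]]]].
exists I, setT, a, b; split=> //; first by move=> x /cov[k xk]; exists k.
rewrite esum_fset; [|exact: finite_finset|]; last first.
  by move=> k _; rewrite lee_fin; apply: prodr_ge0 => i _; rewrite subr_ge0.
rewrite (fsbigE (index_enum I)) ?index_enum_uniq //; last first.
  by move=> k _; rewrite mem_index_enum.
rewrite sumEFin lee_fin (le_trans _ vol) //.
by rewrite le_eqVlt; apply/orP; left; apply/eqP; apply: eq_bigl => k; rewrite in_setT.
Qed.

End MeasureZero.

Section Graphs.
Local Open Scope classical_set_scope.
Variable R : realType.

Lemma measure_zero_bounded_graph (q : nat) (p : 'I_q.+1) (g : 'rV[R]_q.+1 -> R)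
    (C : R) (K : nat) :
  0 <= C ->
  (forall (x y : 'rV[R]_q.+1) (d : R), 0 <= d ->
    (forall j, j != p -> `|x ord0 j - y ord0 j| <= d) ->
    `|g x - g y| <= C * d) ->
  measure_zero [set x : 'rV[R]_q.+1 |
    x ord0 p = g x /\ forall j, - K%:R <= x ord0 j < K%:R].
Proof.
move=> C_ge0 g_lip; apply: measure_zero_finite_cover => e e_gt0.
(* [V / M] is the total volume of the boxes over the cells of side [1 / M]. *)
pose V : R := (2 * K%:R) ^+ q * (2 * C).
have V_ge0 : 0 <= V by rewrite mulr_ge0 ?exprn_ge0 ?mulr_ge0 ?ler0n.
have [M M_gt0 VM] : exists2 M : nat, 0 < M%:R :> R & V / M%:R <= e.
  exists (Num.bound (V / e)).+1; first by rewrite ltr0n.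
  rewrite ler_pdivrMr ?ltr0n // mulrC -ler_pdivrMr //.
  apply: le_trans (ltW (archi_boundP (divr_ge0 V_ge0 (ltW e_gt0)))) _.
  by rewrite ler_nat leqnSn.
(* The cells of the grid in the coordinates other than [p] are indexed by [f], and
   [corner f] is the lower corner of a cell, with coordinate [p] set to [0]. *)
pose corner (f : {ffun 'I_q -> 'I_(2 * K * M)}) : 'rV[R]_q.+1 :=
  \row_i if unlift p i is Some j then - K%:R + (f j)%:R / M%:R else 0.
pose a f : 'rV[R]_q.+1 :=
  \row_i if i == p then g (corner f) - C / M%:R else corner f ord0 i.
pose b f : 'rV[R]_q.+1 :=
  \row_i if i == p then g (corner f) + C / M%:R else corner f ord0 i + M%:R^-1.
have CM_ge0 : 0 <= C / M%:R by rewrite divr_ge0 // ltW.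
have M1_ge0 : 0 <= M%:R^-1 :> R by rewrite invr_ge0 ltW.
exists {ffun 'I_q -> 'I_(2 * K * M)}, a, b; split.
- by move=> f i; rewrite !mxE; case: ifP => _; lra.
- move=> x /= [xp xK].
  have y_ge0 j : 0 <= (x ord0 (lift p j) + K%:R) * M%:R.
    by rewrite mulr_ge0 ?ler0n //; have /andP[+ _] := xK (lift p j); lra.
  (* The bound [x j < K] is strict so that no point falls beyond the last cell. *)
  have f_lt j : (Num.truncn ((x ord0 (lift p j) + K%:R) * M%:R) < 2 * K * M)%N.
    rewrite truncn_lt_nat // !natrM ltr_pM2r //.
    by have /andP[_] := xK (lift p j); lra.
  exists [ffun j => Ordinal (f_lt j)].
  set f := [ffun j => _].
  have close j : j != p -> corner f ord0 j <= x ord0 j <= corner f ord0 j + M%:R^-1.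
    rewrite eq_sym => /unlift_some[k -> unk].
    rewrite !mxE unk ffunE /=.
    have /andP[lo hi] := truncn_itv (y_ge0 k).
    move: lo hi; set z := Num.truncn _ => lo hi.
    have {lo} : z%:R / M%:R <= x ord0 (lift p k) + K%:R by rewrite ler_pdivrMr.
    have {hi} : x ord0 (lift p k) + K%:R < z.+1%:R / M%:R by rewrite ltr_pdivlMr.
    rewrite -natr1 mulrDl mul1r => hi lo; apply/andP; split; lra.
  move=> i; rewrite [a f _ _]mxE [b f _ _]mxE; case: eqP => [->|/eqP/close //].
  have : `|g x - g (corner f)| <= C / M%:R.
    apply: g_lip => // j /close/andP[lo hi]; rewrite ler_norml; apply/andP; split; lra.
  by rewrite xp ler_norml => /andP[lo hi]; apply/andP; split; lra.
- have vol f : \prod_i (b f ord0 i - a f ord0 i) = 2 * C / M%:R * M%:R^-1 ^+ q.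
    rewrite (bigD1_ord p) //= !mxE eqxx; congr (_ * _); first by lra.
    rewrite -[q in RHS]card_ord -prodr_const; apply: eq_bigr => j _.
    by rewrite !mxE eq_sym (negPf (neq_lift p j)); lra.
  rewrite (eq_bigr _ (fun f _ => vol f)) sumr_const card_ffun !card_ord -[_ *+ _]mulr_natr.
  apply: le_trans VM; rewrite le_eqVlt; apply/orP; left; apply/eqP.
  rewrite /V natrX !natrM !exprMn exprVn.
  by field; rewrite expf_neq0 lt0r_neq0.
Qed.

(** A hypersurface that is the graph of a Lipschitz function of all coordinates
    but one is a null set: the part of it in a cube of fixed size lies over
    [O(M ^ (m - 1))] cells of side [1 / M], and over each of them in a box of volume
    [O(M ^- m)]. *)
Lemma measure_zero_graph (m : nat) (p : 'I_m) (g : 'rV[R]_m -> R) (C : R) :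
  0 <= C ->
  (forall (x y : 'rV[R]_m) (d : R), 0 <= d ->
    (forall j, j != p -> `|x ord0 j - y ord0 j| <= d) ->
    `|g x - g y| <= C * d) ->
  measure_zero [set x : 'rV[R]_m | x ord0 p = g x].
Proof.
case: m p g => [[] //|q] p g C_ge0 g_lip.
apply: (@measure_zeroS _ _ _ (\bigcup_K [set x : 'rV[R]_q.+1 |
    x ord0 p = g x /\ forall j, - K%:R <= x ord0 j < K%:R])); last first.
  by apply: measure_zero_bigcup => K; apply: measure_zero_bounded_graph g_lip.
move=> x xp; pose s := \sum_j `|x ord0 j|.
have s_ge0 : 0 <= s by apply: sumr_ge0.
exists (Num.bound s) => //; split=> // j.
have : `|x ord0 j| < (Num.bound s)%:R.
  apply: le_lt_trans (archi_boundP s_ge0).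
  by rewrite /s (bigD1 j) //= lerDl sumr_ge0.
by rewrite ltr_norml => /andP[lo ->]; rewrite ltW.
Qed.

(** The kernel of a nonzero linear form is a null set: it is the graph of a linear
    function of all coordinates but one. *)
Lemma measure_zero_kernel (m : nat) (phi : 'rV[R]_m -> R^o) :
  linear phi -> (exists x, phi x != 0) -> measure_zero [set x | phi x = 0].
Proof.
move=> phi_lin [x0 phi_x0].
have phiE := linear_form_sum phi_lin.
have [p cp_neq0] : exists p, phi (delta_mx ord0 p) != 0.
  apply/existsP; apply: contraNT phi_x0; rewrite negb_exists => /forallP phi0.
  by rewrite phiE big1 // => j _; have := phi0 j; rewrite negbK => /eqP->; rewrite mulr0.
pose c j := - phi (delta_mx ord0 j) / phi (delta_mx ord0 p).
pose g (x : 'rV[R]_m) := \sum_(j | j != p) x ord0 j * c j.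
apply: (@measure_zeroS _ _ _ [set x : 'rV[R]_m | x ord0 p = g x]).
  move=> x /=; rewrite phiE (bigD1 p) //= => /eqP; rewrite addr_eq0 => /eqP xp.
  apply: (mulIf cp_neq0); rewrite xp /g mulr_suml -sumrN.
  by apply: eq_bigr => j _; rewrite /c; field.
apply: (@measure_zero_graph _ p g (\sum_(j | j != p) `|c j|)); first exact: sumr_ge0.
move=> x y d d_ge0 xyd; rewrite /g -sumrB mulr_suml.
apply: le_trans (ler_norm_sum _ _ _) _; apply: ler_sum => j jp.
by rewrite -mulrBl normrM mulrC ler_wpM2l // xyd.
Qed.

End Graphs.

(** * Generic properties *)

Section Generically.
Local Open Scope classical_set_scope.
Variables (R : realType) (m : nat).
Implicit Types P Q : 'rV[R]_m -> Prop.

Lemma genericallyS P Q : (forall t, P t -> Q t) -> generically P -> generically Q.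
Proof. by move=> PQ; apply: measure_zeroS => t /= nQ Pt; apply/nQ/PQ. Qed.

Lemma generically_all P : (forall t, P t) -> generically P.
Proof.
by move=> allP; apply: measure_zeroS (@measure_zero0 R m) => t /= nPt; apply/nPt/allP.
Qed.

Lemma generically_forall (I : countType) (P_ : I -> 'rV[R]_m -> Prop) :
  (forall i, generically (P_ i)) -> generically (fun t => forall i, P_ i t).
Proof.
move=> gP; apply: measure_zeroS (measure_zero_bigcup_countable gP).
by move=> t /= /existsNP[i nPi]; exists i.
Qed.

Lemma generically_and P Q :
  generically P -> generically Q -> generically (fun t => P t /\ Q t).
Proof.
move=> gP gQ; have : generically (fun t => forall b : bool, if b then P t else Q t).
  by apply: generically_forall; case.
by apply: genericallyS => t Pt; split; [apply: (Pt true)|apply: (Pt false)].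
Qed.

Lemma generically_neq0 (phi : 'rV[R]_m -> R^o) :
  linear phi -> (exists x, phi x != 0) -> generically (fun t => phi t != 0).
Proof.
move=> phi_lin phi_neq0; apply: measure_zeroS (measure_zero_kernel phi_lin phi_neq0).
by move=> t /= /negP; rewrite negbK => /eqP.
Qed.

End Generically.

(** * Lower bidiagonal matrices *)

Section Bidiagonal.
Variables (R : comNzRingType) (n : nat) (A : 'M[R]_n.+1).

(** All entries off the diagonal and the first subdiagonal vanish.  For [i : 'I_n], the
    indices of values [i] and [i.+1] are [lift ord_max i] and [lift ord0 i], so that
    the subdiagonal entries are the [A (lift ord0 i) (lift ord_max i)]. *)
Definition lower_bidiagonal :=
  forall i j : 'I_n.+1, i != j -> i != j.+1 :> nat -> A i j = 0.

Hypothesis A_bidiag : lower_bidiagonal.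

Lemma char_poly_bidiagonal : char_poly A = \prod_i ('X - (A i i)%:P).
Proof.
apply: char_poly_trig; apply/is_trig_mxP => i j lt_ij.
by apply: A_bidiag; [rewrite -val_eqE ltn_eqF|rewrite ltn_eqF // ltnS ltnW].
Qed.

(** Deleting the first row and the last column moves the subdiagonal of [A] to the
    diagonal of an upper triangular matrix. *)
Lemma cofactor_bidiagonal :
  cofactor (char_poly_mx A) ord0 ord_max =
    (\prod_(i < n) A (lift ord0 i) (lift ord_max i))%:P.
Proof.
have lift_eq (i j : 'I_n) : (lift ord0 i == lift ord_max j) = (i.+1 == j :> nat).
  by rewrite -(inj_eq (@ord_inj _)) lift0 lift_max.
rewrite /cofactor -det_tr det_trig; last first.
  apply/is_trig_mxP => i j lt_ij; rewrite !mxE lift_eq gtn_eqF; last by rewrite ltnS ltnW.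
  rewrite mulr0n sub0r A_bidiag ?oppr0 //; first by rewrite lift_eq gtn_eqF // ltnS ltnW.
  by rewrite lift0 lift_max eqSS gtn_eqF.
rewrite rmorph_prod /= add0n.
under eq_bigr => i _ do rewrite !mxE lift_eq gtn_eqF // mulr0n sub0r -mulN1r.
by rewrite big_split prodr_const /= card_ord mulrA -expr2 sqrr_sign mul1r.
Qed.

End Bidiagonal.

(** * Fibres of the coefficient map *)

Section Fibres.
Variables (n : nat) (M : compartmental_model n) (R : realType).
Variable mx : param_space M R -> 'M[R]_n.
Implicit Types t : param_space M R.

(** The coefficients that the coefficient map leaves out are constant. *)
Lemma io_coef_fibre t t' j o k :
  coefficient_map mx t = coefficient_map mx t' ->
  j \in outputs M -> (if o is Some i then i \in inputs M else true) ->
  io_coef (mx t) (j, o, k) = io_coef (mx t') (j, o, k).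
Proof.
move=> ct jM oM; set x := (j, o, k).
have [xrel|] := boolP (relevant_coef mx x).
  by have /ffunP/(_ (exist _ x xrel)) := ct; rewrite !ffunE.
rewrite /relevant_coef /= jM oM /= negb_and => /orP[] /asboolPn/forallNP cst.
  by have /negP := cst t; have /negP := cst t'; rewrite !negbK => /eqP-> /eqP->.
by have /negP := cst t; have /negP := cst t'; rewrite !negbK => /eqP-> /eqP->.
Qed.

Lemma char_poly_fibre t t' :
  coefficient_map mx t = coefficient_map mx t' ->
  char_poly (mx t) = char_poly (mx t').
Proof.
move=> ct; apply/polyP => k; have [lt_kn|le_nk] := ltnP k n.+1; last first.
  by rewrite !nth_default ?size_char_poly.
have /finset.set0Pn[j jM] := outputs_neq0 M.
exact: (@io_coef_fibre t t' j None (Ordinal lt_kn)).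
Qed.

(** A function with finitely many values on each fibre of the coefficient map is
    locally identifiable: the values on the fibre are the finitely multivalued
    function of the coefficients. *)
Lemma locally_identifiable_from_fibre (f : param_space M R -> R) :
  (forall t0, finite_set [set f t | t in [set t |
     coefficient_map mx t = coefficient_map mx t0]]%classic) ->
  locally_identifiable_from (coefficient_map mx) f.
Proof.
move=> fin; exists (fun y => [set f t | t in [set t | coefficient_map mx t = y]]%classic).
split; last by apply: generically_all => t; exists t.
move=> y; have [[t0 <-]|no] := pselect (exists t0, coefficient_map mx t0 = y).
  exact: fin.
rewrite (_ : [set f t | t in _]%classic = set0) //.
by apply/seteqP; split=> // v [t ct _]; apply: no; exists t.
Qed.

End Fibres.

(** * Values of the model parameters *)

Section ParamValues.
Variables (n : nat) (M : compartmental_model n) (R : realType).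
Implicit Types t : param_space M R.

Lemma edge_valE t (e : edge_type M) :
  edge_val t (val e).1 (val e).2 = param_val t (inl e).
Proof. by rewrite /edge_val -surjective_pairing valK. Qed.

Lemma leak_valE t (l : leak_type M) : leak_val t (val l) = param_val t (inr l).
Proof. by rewrite /leak_val valK. Qed.

Lemma edge_val0 t i j : ~~ edge M i j -> edge_val t i j = 0.
Proof. by move=> nE; rewrite /edge_val insubN. Qed.

Lemma leak_val0 t i : i \notin leaks M -> leak_val t i = 0.
Proof. by move=> nL; rewrite /leak_val insubN. Qed.

Lemma param_val_ext t t' : param_val t =1 param_val t' -> t = t'.
Proof.
by move=> eq_t; apply/rowP => k; rewrite -(enum_valK k); apply: eq_t.
Qed.

Lemma edge_val_linear i j : linear (fun t => edge_val t i j : R^o).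
Proof.
move=> a t t'; rewrite /edge_val; case: insub => [e|]; last by rewrite scaler0 addr0.
by rewrite /param_val !mxE.
Qed.

Lemma leak_val_linear i : linear (fun t => leak_val t i : R^o).
Proof.
move=> a t t'; rewrite /leak_val; case: insub => [e|]; last by rewrite scaler0 addr0.
by rewrite /param_val !mxE.
Qed.

Lemma compartmental_mx_linear i j :
  linear (fun t => compartmental_mx t i j : R^o).
Proof.
move=> a t t'; rewrite !mxE; case: ifP => _; last exact: edge_val_linear.
rewrite leak_val_linear (eq_bigr _ (fun k _ => edge_val_linear i k a t t')).
by rewrite big_split -scaler_sumr /= !opprD addrACA scalerDr !scalerN.
Qed.

End ParamValues.

(** * The path model *)

Section PathModel.
Variables (n : nat) (L : {set 'I_n.+1}) (R : realType).
Local Notation M := (path_model L).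
Implicit Types t : param_space M R.

Lemma path_edge_lift (i : 'I_n) : path_edge (lift ord_max i) (lift ord0 i).
Proof. by rewrite /path_edge lift_max lift0. Qed.

Lemma path_edgeP (i j : 'I_n.+1) :
  reflect (exists k, i = lift ord_max k /\ j = lift ord0 k) (path_edge i j).
Proof.
apply: (iffP eqP) => [ij|[k [-> ->]]]; last by rewrite lift_max lift0.
have lt_in : (i < n)%N by rewrite -ltnS -ij.
by exists (Ordinal lt_in); split; apply: ord_inj; rewrite ?lift_max ?lift0.
Qed.

(** The edge between the vertices of values [i] and [i.+1]. *)
Definition path_arc (i : 'I_n) : edge_type M :=
  exist _ (lift ord_max i, lift ord0 i) (path_edge_lift i).

Lemma path_arc_surj (e : edge_type M) : exists i, e = path_arc i.
Proof.
have [k [e1 e2]] := path_edgeP _ _ (valP e).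
by exists k; apply: val_inj; rewrite /= -e1 -e2 -surjective_pairing.
Qed.

Lemma edge_val_path_arc t i :
  edge_val t (lift ord_max i) (lift ord0 i) = param_val t (inl (path_arc i)).
Proof. exact: edge_valE t (path_arc i). Qed.

Lemma compartmental_mx_bidiagonal t : lower_bidiagonal (compartmental_mx t).
Proof. by move=> i j neq nS; rewrite mxE (negPf neq) edge_val0. Qed.

Lemma diag_compartmental_mx_bidiagonal t : lower_bidiagonal (diag_compartmental_mx t).
Proof. by move=> i j neq nS; rewrite mxE (negPf neq) edge_val0. Qed.

Lemma neq_lift0_max (i : 'I_n) : lift ord0 i != lift ord_max i.
Proof. by rewrite -(inj_eq (@ord_inj _)) lift0 lift_max gtn_eqF. Qed.

Lemma compartmental_mx_subdiag t i :
  compartmental_mx t (lift ord0 i) (lift ord_max i) = param_val t (inl (path_arc i)).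
Proof. by rewrite mxE (negPf (neq_lift0_max i)) edge_val_path_arc. Qed.

Lemma diag_compartmental_mx_subdiag t i :
  diag_compartmental_mx t (lift ord0 i) (lift ord_max i) =
    param_val t (inl (path_arc i)).
Proof. by rewrite mxE (negPf (neq_lift0_max i)) edge_val_path_arc. Qed.

Section Fibres.
Variable mx : param_space M R -> 'M[R]_n.+1.
Hypothesis mx_bidiag : forall t, lower_bidiagonal (mx t).

(** The eigenvalues of a bidiagonal matrix are its diagonal entries. *)
Lemma diag_fibre t t' i :
  coefficient_map mx t = coefficient_map mx t' ->
  exists j, mx t i i = mx t' j j.
Proof.
move=> /char_poly_fibre; rewrite !char_poly_bidiagonal // => eq_prod.
have : root (\prod_j ('X - (mx t' j j)%:P)) (mx t i i).
  by rewrite -eq_prod /root horner_prod prodf_seq_eq0; apply/hasP; exists i;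
     rewrite ?mem_index_enum //= hornerXsubC subrr.
rewrite /root horner_prod prodf_seq_eq0 => /hasP[j _ /=].
by rewrite hornerXsubC subr_eq0 => /eqP; exists j.
Qed.

(** The product of all edge parameters is the only coefficient on the input side
    of the input-output equation. *)
Lemma prod_subdiag_fibre t t' :
  coefficient_map mx t = coefficient_map mx t' ->
  \prod_i mx t (lift ord0 i) (lift ord_max i) =
  \prod_i mx t' (lift ord0 i) (lift ord_max i).
Proof.
move=> ct; have := @io_coef_fibre _ M R mx t t' ord_max (Some ord0) ord0 ct.
by rewrite !inE !eqxx /io_coef !cofactor_bidiagonal // !coefC; apply.
Qed.

End Fibres.

(** * Cycles and paths of the path model *)

Lemma last_iotaS k l : last k (iota k.+1 l) = (k + l)%N.
Proof. by elim: l k => [|l IHl] k /=; rewrite ?addn0 // IHl addSnnS. Qed.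

Lemma path_edge_no_cycle (x : 'I_n.+1) s : ~~ cycle (@path_edge n) (x :: s).
Proof.
apply/negP => /= xsx.
have lt_path : path ltn x (map val (rcons s x)).
  by rewrite path_map; apply: sub_path xsx => i j; rewrite /path_edge /= => /eqP->.
have := order_path_min ltn_trans lt_path.
by rewrite map_rcons all_rcons /= ltnn.
Qed.

Lemma monomial_cycleE (m : seq (param M)) :
  monomial_cycle m -> exists x, m = walk_params M x [:: x].
Proof.
move=> [x [s [_ cyc ->]]]; exists x; case: s cyc => [|y s] //.
by rewrite orFb (negPf (path_edge_no_cycle x (y :: s))).
Qed.

Lemma path_edge_iotaE (x : 'I_n.+1) s :
  path (@path_edge n) x s = (map val s == iota x.+1 (size s)).
Proof.
by elim: s x => [|y s IHs] x //=; rewrite IHs eqseq_cons /path_edge;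
  case: eqP => //= ->.
Qed.

(** The only walk from the input to the output runs through all vertices in order. *)
Lemma path_edge_full_walk (s : seq 'I_n.+1) :
  path (@path_edge n) ord0 s -> last ord0 s = ord_max ->
  s = [seq lift ord0 i | i <- enum 'I_n].
Proof.
rewrite path_edge_iotaE => /eqP s_iota last_s.
have size_s : size s = n.
  have : val (last ord0 s) = n by rewrite last_s.
  rewrite -(last_map val) s_iota.
  by rewrite last_iotaS add0n.
apply: (inj_map val_inj); rewrite s_iota size_s -[LHS]/(behead (iota 0 n.+1)).
by rewrite -val_enum_ord enum_ordSl.
Qed.

Lemma full_walk_io :
  let s := [seq lift ord0 i | i <- enum 'I_n] in
  [/\ path (@path_edge n) ord0 s, last ord0 s = ord_max & uniq (ord0 :: s)].
Proof.
move=> s; have sE : ord0 :: s = enum 'I_n.+1 by rewrite enum_ordSl.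
have s_iota : map val s = iota 1 n.
  by rewrite -[LHS]/(behead (map val (ord0 :: s))) sE val_enum_ord.
have size_s : size s = n by rewrite -(size_map val) s_iota size_iota.
split; last by rewrite sE enum_uniq.
- by rewrite path_edge_iotaE s_iota size_s.
- apply: val_inj; rewrite -(last_map val) s_iota /=.
  exact: last_iotaS.
Qed.

Lemma walk_params_full :
  walk_params M ord0 [seq lift ord0 i | i <- enum 'I_n] =
    [seq inl (path_arc i) | i <- enum 'I_n].
Proof.
set s := map _ _; have sE : ord0 :: s = enum 'I_n.+1 by rewrite enum_ordSl.
have -> : walk_params M ord0 s =
    pmap (arc_param M) [seq (lift ord_max i, lift ord0 i) | i <- enum 'I_n].
  congr pmap; apply: (@eq_from_nth _ (ord0, ord0)).
    by rewrite size_pairmap !size_map.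
  move=> k; rewrite size_pairmap size_map => lt_k.
  have lt_kn : (k < n)%N by rewrite -(size_enum_ord n).
  rewrite (nth_pairmap ord0); last by rewrite size_map.
  rewrite -[nth ord0 s k]/(nth ord0 (ord0 :: s) k.+1) sE.
  have -> : nth (ord0, ord0) [seq (lift ord_max i, lift ord0 i) | i <- enum 'I_n] k =
      (lift ord_max (Ordinal lt_kn), lift ord0 (Ordinal lt_kn)).
    rewrite (nth_map (Ordinal lt_kn)); last by rewrite size_enum_ord.
    by rewrite (nth_ord_enum _ (Ordinal lt_kn)).
  by congr (_, _); apply: ord_inj; rewrite ?lift_max ?lift0 nth_enum_ord // ltnW.
elim: (enum _) => //= i r IHr; rewrite IHr /arc_param /=.
by rewrite eq_sym (negPf (neq_lift0_max i)) (valK (path_arc i)).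
Qed.

Lemma monomial_io_pathE (m : seq (param M)) :
  monomial_io_path m <-> m = [seq inl (path_arc i) | i <- enum 'I_n].
Proof.
split=> [[x [s [+ + _ sP ->]]]|->].
  rewrite !inE => /eqP x0 /eqP; rewrite {}x0 in sP * => lastP.
  by rewrite -walk_params_full -(path_edge_full_walk sP lastP).
have [sP lastP s_uniq] := full_walk_io.
by exists ord0, [seq lift ord0 i | i <- enum 'I_n]; split=> //;
  rewrite ?inE ?lastP ?eqxx // walk_params_full.
Qed.

End PathModel.

(** * Leaks in every compartment *)

Section FullLeaks.
Variables (n : nat) (R : realType).
Local Notation M := (@path_model n [set: 'I_n.+1]%SET).

Lemma leak_type_full (x : 'I_n.+1) : exists l : leak_type M, x = val l.
Proof.
have xL : x \in leaks M by rewrite inE.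
by exists (exist _ x xL).
Qed.

Lemma self_cycle (l : leak_type M) : walk_params M (val l) [:: val l] = [:: inr l].
Proof. by rewrite /walk_params /= /arc_param /= eqxx valK. Qed.

Lemma path_model_identifiable_path_cycle : identifiable_path_cycle_model M R.
Proof.
split=> //.
- move=> m mono; apply: locally_identifiable_from_fibre => t0.
  case: mono => [/monomial_cycleE[x ->]|/monomial_io_pathE ->].
    have [l ->] := leak_type_full x; rewrite self_cycle.
    apply: (@sub_finite_set _ _
      [set diag_compartmental_mx t0 j j | j in [set: 'I_n.+1]]%classic); last first.
      exact: finite_image.
    move=> _ [t /= ct <-].
    have [j eq_j] := diag_fibre (@diag_compartmental_mx_bidiagonal _ _ R) (val l) ct.
    exists j => //; rewrite -eq_j mxE eqxx leak_valE.
    by rewrite /monomial_val big_cons big_nil mulr1.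
  apply: (@sub_finite_set _ _
    [set \prod_i diag_compartmental_mx t0 (lift ord0 i) (lift ord_max i)]%classic).
    move=> _ [t /= ct <-].
    rewrite -(prod_subdiag_fibre (@diag_compartmental_mx_bidiagonal _ _ R) ct).
    rewrite /monomial_val big_map big_enum.
    by apply: eq_bigr => i _; rewrite diag_compartmental_mx_subdiag.
  exact: finite_set1.
- case=> [e|l].
    have [i ->] := path_arc_surj e.
    exists [seq inl (path_arc _ i) | i <- enum 'I_n].
      by right; apply/monomial_io_pathE.
    by apply: map_f; rewrite mem_enum.
  exists [:: inr l]; last by rewrite inE.
  by left; exists (val l), [::]; rewrite self_cycle.
Qed.

End FullLeaks.

(** * Leaks at the two ends *)

Section EndLeaks.
Variables (n : nat) (R : realType).
Local Notation M := (@path_model n [set ord0; ord_max]%SET).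
Local Notation A := (@compartmental_mx _ M R).
Implicit Types t : param_space M R.

Lemma compartmental_mx_diag_lift t (i : 'I_n) :
  A t (lift ord_max i) (lift ord_max i) =
    - leak_val t (lift ord_max i) - param_val t (inl (path_arc _ i)).
Proof.
rewrite mxE eqxx (bigD1 (lift ord0 i)); last exact: path_edge_lift.
rewrite /= edge_val_path_arc big1 ?addr0 // => k /andP[/path_edgeP[j [/lift_inj <- ->]]].
by rewrite eqxx.
Qed.

Lemma compartmental_mx_diag_max t : A t ord_max ord_max = - leak_val t ord_max.
Proof.
rewrite mxE eqxx big1 ?subr0 // => k /eqP /= kn.
by have := ltn_ord k; rewrite kn ltnn.
Qed.

(** The parameters can be recovered from the matrix: inner diagonal entries are
    opposites of edge parameters, and the first edge parameter is the quotient of the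
    product of all of them by the product of the others. *)
Lemma compartmental_mx_inj t t' :
  (forall i, A t i i = A t' i i) ->
  \prod_i A t (lift ord0 i) (lift ord_max i) =
    \prod_i A t' (lift ord0 i) (lift ord_max i) ->
  (forall i, A t (lift ord0 i) (lift ord_max i) != 0) ->
  t = t'.
Proof.
move=> eq_diag eq_prod t_neq0.
have eq_inner (i : 'I_n) : (0 < i)%N ->
    param_val t (inl (path_arc _ i)) = param_val t' (inl (path_arc _ i)).
  move=> i_gt0; have no_leak : lift ord_max i \notin leaks M.
    rewrite !inE negb_or (eq_sym _ ord_max) neq_lift andbT.
    by rewrite -(inj_eq (@ord_inj _)) lift_max -lt0n.
  have := eq_diag (lift ord_max i); rewrite !compartmental_mx_diag_lift.
  by rewrite !leak_val0 // oppr0 !add0r; apply: oppr_inj.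
have eq_edge (i : 'I_n) :
    param_val t (inl (path_arc _ i)) = param_val t' (inl (path_arc _ i)).
  case: (posnP i) => [i0|]; last exact: eq_inner.
  move: eq_prod; rewrite (bigD1 i) // [in RHS](bigD1 i) //=.
  rewrite !compartmental_mx_subdiag.
  rewrite [X in _ * X = _](eq_bigr (fun j =>
    A t' (lift ord0 j) (lift ord_max j))) => [|j ji].
    apply: mulIf; apply/prodf_neq0 => j ji.
    rewrite compartmental_mx_subdiag -eq_inner -?(compartmental_mx_subdiag t) //.
    by rewrite lt0n -i0 (inj_eq (@ord_inj _)).
  by rewrite !compartmental_mx_subdiag eq_inner // lt0n -i0 (inj_eq (@ord_inj _)).
apply: param_val_ext => -[e|l]; first by have [i ->] := path_arc_surj e.
rewrite -!leak_valE; apply: oppr_inj; have := eq_diag (val l).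
case: (unliftP ord_max (val l)) => [i ->|->]; last by rewrite !compartmental_mx_diag_max.
by rewrite !compartmental_mx_diag_lift eq_edge => /addIr.
Qed.

(** The generic points at which local injectivity holds: distinct diagonal entries and
    nonzero edge parameters.  Pairs and differences make both conditions finite
    conjunctions of the nonvanishing of linear forms. *)
Definition nondegenerate t :=
  (forall ij : 'I_n.+1 * 'I_n.+1,
     ij.1 != ij.2 -> A t ij.1 ij.1 - A t ij.2 ij.2 != 0) /\
  (forall i, A t (lift ord0 i) (lift ord_max i) != 0).

Lemma generically_nondegenerate : generically nondegenerate.
Proof.
apply: generically_and;
  [apply: generically_forall => -[i j] /=|apply: generically_forall => i].
  have [->|neq_ij] := eqVneq i j.
    exact: generically_all.
  apply: (@genericallyS _ _ (fun t => A t i i - A t j j != 0)) => [t //|].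
  apply: (@generically_neq0 _ _ (fun t => A t i i - A t j j)).
    move=> a t t' /=; rewrite !compartmental_mx_linear scalerBr.
    by rewrite opprD addrACA.
  (* With weight [k] on the edge out of the vertex of value [k], no leak at the first
     vertex and a leak of [n] at the last, the diagonal is [0, -1, ..., -n]. *)
  pose t : param_space M R := \row_(p < #|{: param M}|)
    match enum_val p with inl e => (val e).1%:R | inr l => (val l)%:R end.
  have leakE k : k \in leaks M -> leak_val t k = k%:R.
    move=> kL; have := leak_valE t (Sub k kL).
    by rewrite SubK => ->; rewrite /param_val mxE enum_rankK SubK.
  have diagE k : A t k k = - (k%:R).
    case: (unliftP ord_max k) => [l ->|->]; last first.
      by rewrite compartmental_mx_diag_max leakE // !inE eqxx orbT.
    rewrite compartmental_mx_diag_lift /param_val mxE enum_rankK /=.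
    suff -> : leak_val t (lift ord_max l) = 0 by rewrite oppr0 add0r.
    have [lL|] := boolP (lift ord_max l \in leaks M); last exact: leak_val0.
    rewrite leakE //; move: lL.
    by rewrite !inE (eq_sym _ ord_max) (negPf (neq_lift _ _)) orbF => /eqP->.
  by exists t; rewrite !diagE opprK addrC subr_eq0 eqr_nat eq_sym (inj_eq (@ord_inj _)).
apply: generically_neq0; first exact: compartmental_mx_linear.
exists (const_mx 1); rewrite compartmental_mx_subdiag /param_val mxE.
exact: oner_neq0.
Qed.

Lemma path_model_locally_identifiable : locally_identifiable R M.
Proof.
apply: genericallyS generically_nondegenerate => t [diag_neq edge_neq0].
have A_cont i j : continuous (fun s => A s i j).
  exact: (linear_form_continuous (@compartmental_mx_linear _ M R i j)).
(* Within half the gap between two diagonal entries at [t], nearby values of these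
   entries stay apart. *)
exists [set s | (forall ij : 'I_n.+1 * 'I_n.+1, ij.1 != ij.2 ->
      `|A t ij.1 ij.1 - A s ij.1 ij.1| < `|A t ij.1 ij.1 - A t ij.2 ij.2| / 2) /\
    (forall i, A s (lift ord0 i) (lift ord_max i) != 0)]%classic.
  have nbhs1 : \forall s \near t, forall ij : 'I_n.+1 * 'I_n.+1, ij.1 != ij.2 ->
      `|A t ij.1 ij.1 - A s ij.1 ij.1| < `|A t ij.1 ij.1 - A t ij.2 ij.2| / 2.
    apply: (filter_forall (nbhs_filter t)) => -[i j] /=; have [->|neq_ij] := eqVneq i j.
      by apply: filterE => s.
    have gap : 0 < `|A t i i - A t j j| / 2.
      by rewrite divr_gt0 // normr_gt0 (diag_neq (i, j)).
    have /cvgrPdist_lt/(_ _ gap) := A_cont i i t.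
    exact: filterS.
  have nbhs2 : \forall s \near t, forall i, A s (lift ord0 i) (lift ord_max i) != 0.
    apply: (filter_forall (nbhs_filter t)) => i.
    have e_gt0 : 0 < `|A t (lift ord0 i) (lift ord_max i)| by rewrite normr_gt0.
    have /cvgrPdist_lt/(_ _ e_gt0) := A_cont (lift ord0 i) (lift ord_max i) t.
    apply: filterS => s; apply: contraTneq => ->.
    by rewrite subr0 ltxx.
  by apply: filterS2 nbhs1 nbhs2 => s.
move=> s s'; rewrite !inE /= => -[s_near s_neq0] [s'_near _] cs.
have A_bidiag := @compartmental_mx_bidiagonal n [set ord0; ord_max]%SET R.
apply: compartmental_mx_inj s_neq0; last exact: prod_subdiag_fibre cs.
move=> i; have [j eq_ij] := diag_fibre A_bidiag i cs.
have [ij|neq_ij] := eqVneq i j; first by rewrite eq_ij ij.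
have := s_near (i, j) neq_ij; have := s'_near (j, i); rewrite eq_sym => /(_ neq_ij) /=.
rewrite eq_ij (distrC (A t j j) (A t i i)) => h1 h2.
have := ler_distD (A s' j j) (A t i i) (A t j j).
rewrite (distrC (A s' j j)); lra.
Qed.

End EndLeaks.

Theorem proposition3p29 (R : realType) (n : nat) :
  identifiable_path_cycle_model (@path_model n [set: 'I_n.+1]%SET) R /\
  locally_identifiable R (@path_model n [set ord0; ord_max]%SET).
Proof.
split; first exact: path_model_identifiable_path_cycle.
exact: path_model_locally_identifiable.
Qed.
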